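(* Concerning bivariate discrete phase-type distributions, the CDPH class satisfies the relationships $$\text{mDPH}\subset\text{CDPH (with support }(\mathbb{N}+1)\times(\mathbb{N}+1)),$$ $$\text{CDPH (with support }(\mathbb{N}+2)\times(\mathbb{N}+2))\subset\operatorname{MDPH}^*,$$ where $\subset$ denotes inclusion of classes of bivariate distributions.
   Context: $\mathbb{N}=\{0,1,2,\dots\}$. A subprobability matrix has nonnegative entries and row sums at most $1$; a terminating Markov chain with such a matrix terminates at the next step with the missing row mass. All terminating chains are assumed to terminate almost surely. CDPH. $\mathcal{E}$ and $\mathcal{S}$ are disjoint nonempty finite sets; $\bm{\alpha}$ is a probability row vector indexed by $\mathcal{E}$; $\bm{P}$ is a subprobability matrix on $\mathcal{E}$; $\bm{U}$ is a nonnegative $\mathcal{E}\times\mathcal{S}$ matrix such that each row of $(\bm{P}\ \bm{U})$ sums to one; $\bm{Q}_1,\bm{Q}_2$ are subprobability matrices on $\mathcal{S}$. $M_1$ is a terminating Markov chain (time $n=0,1,2,\dots$) on $\mathcal{E}\cup\mathcal{S}$ with initial vector $(\bm{\alpha},\bm{0})$ and subprobability matrix $\begin{pmatrix}\bm{P}&\bm{U}\\ \bm{0}&\bm{Q}_1\end{pmatrix}$. Let $\tau_{1,2}:=\inf\{n\ge 1: M_1(n)\notin\mathcal{E}\}$. Set $M_2(n)=M_1(n)$ for $n\le\tau_{1,2}$; after time $\tau_{1,2}$, given the past up to $\tau_{1,2}$, $M_2$ evolves independently of $M_1$ as a terminating Markov chain in $\mathcal{S}$ with subprobability matrix $\bm{Q}_2$.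 For $k\in\{1,2\}$, $\tau_k:=\inf\{n\ge 1: M_k(n)\notin\mathcal{E}\cup\mathcal{S}\}$. The law of $(\tau_1,\tau_2)$ is a CDPH distribution with support $(\mathbb{N}+2)\times(\mathbb{N}+2)$; the law of $(\tau_1-1,\tau_2-1)$ is a CDPH distribution with support $(\mathbb{N}+1)\times(\mathbb{N}+1)$. The classes consist of all such laws over all choices of $\mathcal{E},\mathcal{S}$ and parameters. mDPH (bivariate). The law of the pair of termination times $(\inf\{n\ge1: L_1(n)\text{ terminated}\},\inf\{n\ge1: L_2(n)\text{ terminated}\})$ of two terminating Markov chains $L_1,L_2$ on a common finite state space that start in the same state $L_1(0)=L_2(0)$, drawn from a probability vector $\bm{\beta}$, and from there onwards evolve independently (given this state), both according to the same subprobability matrix $\bm{Q}$. $\operatorname{MDPH}^*$ (bivariate). The law of $\left(\sum_{\ell=0}^{\sigma-1}r_1(\gamma(\ell)),\ \sum_{\ell=0}^{\sigma-1}r_2(\gamma(\ell))\right)$, where $\gamma$ is a terminating Markov chain on a finite state space, $\sigma$ is its termination time, and $r_1,r_2$ are functions from the state space to $\mathbb{N}$ (state-dependent integer-valued rewards). *)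

(* Defs.v *)
From HB Require Import structures.
From mathcomp Require Import all_boot all_order all_algebra.
From mathcomp Require Import all_classical all_reals all_analysis.

Set Implicit Arguments.
Unset Strict Implicit.
Unset Printing Implicit Defensive.

Import Order.TTheory GRing.Theory Num.Theory.

Local Open Scope classical_set_scope.
Local Open Scope ring_scope.

(* Vectors and matrices are indexed by arbitrary finite types, so they are
   plain functions [X -> R] and [X -> Y -> R]. *)

Definition probability_vector (R : realType) (X : finType) (a : X -> R) : Prop :=
  (forall x, 0 <= a x) /\ \sum_x a x = 1.

Definition subprobability_matrix (R : realType) (X : finType)
    (Q : X -> X -> R) : Prop :=
  (forall x y, 0 <= Q x y) /\ (forall x, \sum_y Q x y <= 1).

Definition block_vector (R : realType) (X Y : finType) (a : X -> R) (b : Y -> R)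
    (z : X + Y) : R :=
  match z with inl x => a x | inr y => b y end.

Definition block_matrix (R : realType) (X Y : finType)
    (A : X -> X -> R) (B : X -> Y -> R) (C : Y -> X -> R) (D : Y -> Y -> R)
    (z z' : X + Y) : R :=
  match z, z' with
  | inl x, inl x' => A x x'
  | inl x, inr y' => B x y'
  | inr y, inl x' => C y x'
  | inr y, inr y' => D y y'
  end.

(* A terminating process on X takes values in [option X], where [None] means
   "terminated". The missing row mass of Q is the termination probability, and
   termination is absorbing. *)
Definition transition (R : realType) (X : finType) (Q : X -> X -> R)
    (x y : option X) : R :=
  match x, y with
  | Some i, Some j => Q i j
  | Some i, None => 1 - \sum_j Q i j
  | None, Some _ => 0
  | None, None => 1
  end.

(* [first_time p] is inf {n >= 1 : p n}; [None] stands for infinity. *)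
Definition first_time (p : pred nat) : option nat :=
  match pselect (exists n, (0 < n)%N && p n) with
  | left h => Some (ex_minn h)
  | right _ => None
  end.

Definition le_time (n : nat) (t : option nat) : bool :=
  if t is Some k then (n <= k)%N else true.

Definition termination_time (T : Type) (X : finType)
    (Z : nat -> T -> option X) (w : T) : option nat :=
  first_time (fun n => Z n w == None).

Definition path_event (T : Type) (X : finType) (Z : nat -> T -> option X)
    (n : nat) (x : nat -> option X) : set T :=
  [set w | forall i, (i <= n)%N -> Z i w = x i].

Definition measurable_process d (T : measurableType d) (X : finType)
    (Z : nat -> T -> option X) : Prop :=
  forall n x, measurable (Z n @^-1` [set x]).

(* Conditional probabilities given an event are written in product form, so
   that null events impose nothing. *)
Definition markov_given (R : realType) d (T : measurableType d)
    (P : probability T R) (X : finType) (B : set T)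
    (Z : nat -> T -> option X) (Q : X -> X -> R) : Prop :=
  forall (n : nat) (x : nat -> option X) (y : option X),
    (P (B `&` path_event Z n x `&` (Z n.+1 @^-1` [set y])) =
     P (B `&` path_event Z n x) * (transition Q (x n) y)%:E)%E.

(* Conditional independence, given B, of the sigma-algebras of Z1 and Z2,
   expressed on the generating pi-systems of path events. *)
Definition independent_given (R : realType) d (T : measurableType d)
    (P : probability T R) (X Y : finType) (B : set T)
    (Z1 : nat -> T -> option X) (Z2 : nat -> T -> option Y) : Prop :=
  forall (m n : nat) (x : nat -> option X) (y : nat -> option Y),
    (P (B `&` path_event Z1 m x `&` path_event Z2 n y) * P B =
     P (B `&` path_event Z1 m x) * P (B `&` path_event Z2 n y))%E.

Definition terminates_as (R : realType) d (T : measurableType d)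
    (P : probability T R) (X : finType) (Z : nat -> T -> option X) : Prop :=
  {ae P, forall w, exists n, termination_time Z w = Some n}.

Definition terminating_chain (R : realType) d (T : measurableType d)
    (P : probability T R) (X : finType) (Z : nat -> T -> option X)
    (a : X -> R) (Q : X -> X -> R) : Prop :=
  [/\ measurable_process Z,
      forall x, P (Z 0%N @^-1` [set Some x]) = (a x)%:E,
      markov_given P setT Z Q
    & terminates_as P Z].

Definition bivariate_law (R : realType) := probability (nat * nat)%type R.

Definition has_law (R : realType) d (T : measurableType d)
    (P : probability T R) (X Y : T -> option nat) (mu : bivariate_law R) : Prop :=
  forall A : set (nat * nat), measurable A ->
    mu A = P [set w | exists2 k, A k & X w = Some k.1 /\ Y w = Some k.2].

Definition in_left (E S : finType) (z : option (E + S)) : bool :=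
  if z is Some (inl _) then true else false.

(* The time tau_{1,2} = inf {n >= 1 : M1(n) not in E}. *)
Definition exit_time (T : Type) (E S : finType)
    (M1 : nat -> T -> option (E + S)) (w : T) : option nat :=
  first_time (fun n => ~~ in_left (M1 n w)).

Definition past_event (T : Type) (E S : finType)
    (M1 : nat -> T -> option (E + S)) (t : nat) (h : nat -> option (E + S)) :
    set T :=
  [set w | exit_time M1 w = Some t] `&` path_event M1 t h.

Definition cdph_parameters (R : realType) (E S : finType) (alpha : E -> R)
    (P : E -> E -> R) (U : E -> S -> R) (Q1 Q2 : S -> S -> R) : Prop :=
  (0 < #|E|)%N /\ (0 < #|S|)%N /\
  probability_vector alpha /\
  subprobability_matrix P /\
  (forall e s, 0 <= U e s) /\
  (forall e, \sum_e' P e e' + \sum_s U e s = 1) /\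
  subprobability_matrix Q1 /\ subprobability_matrix Q2.

(* After tau_{1,2} the chain M2 lives in S; seen on the disjoint union E + S,
   its matrix is Q2 padded with zero blocks (E is never reached from S). *)
Definition cdph_chains (R : realType) (E S : finType) (alpha : E -> R)
    (P : E -> E -> R) (U : E -> S -> R) (Q1 Q2 : S -> S -> R)
    d (T : measurableType d) (Pr : probability T R)
    (M1 M2 : nat -> T -> option (E + S)) : Prop :=
  terminating_chain Pr M1 (block_vector alpha (fun _ => 0))
    (block_matrix P U (fun _ _ => 0) Q1) /\
  measurable_process M2 /\
  (forall n w, le_time n (exit_time M1 w) -> M2 n w = M1 n w) /\
  (forall t h,
     markov_given Pr (past_event M1 t h) (fun n => M2 (t + n)%N)
       (block_matrix (fun _ _ => 0) (fun _ _ => 0) (fun _ _ => 0) Q2)) /\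
  (forall t h,
     independent_given Pr (past_event M1 t h)
       (fun n => M1 (t + n)%N) (fun n => M2 (t + n)%N)) /\
  terminates_as Pr M2.

(* The laws of (tau_1 - j, tau_2 - j). *)
Definition CDPH_shifted (R : realType) (j : nat) : set (bivariate_law R) :=
  [set mu | exists (E S : finType) (alpha : E -> R) (P : E -> E -> R)
      (U : E -> S -> R) (Q1 Q2 : S -> S -> R)
      (d : measure_display) (T : measurableType d) (Pr : probability T R)
      (M1 M2 : nat -> T -> option (E + S)),
    [/\ cdph_parameters alpha P U Q1 Q2,
        cdph_chains alpha P U Q1 Q2 Pr M1 M2
      & has_law Pr
          (fun w => omap (fun n => (n - j)%N) (termination_time M1 w))
          (fun w => omap (fun n => (n - j)%N) (termination_time M2 w)) mu]].

(* Support (N+2) x (N+2), respectively (N+1) x (N+1). *)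
Definition CDPH_2 (R : realType) : set (bivariate_law R) := @CDPH_shifted R 0.
Definition CDPH_1 (R : realType) : set (bivariate_law R) := @CDPH_shifted R 1.

Definition mDPH (R : realType) : set (bivariate_law R) :=
  [set mu | exists (X : finType) (beta : X -> R) (Q : X -> X -> R)
      (d : measure_display) (T : measurableType d) (Pr : probability T R)
      (L1 L2 : nat -> T -> option X),
    (probability_vector beta /\ subprobability_matrix Q) /\
    [/\ terminating_chain Pr L1 beta Q,
        terminating_chain Pr L2 beta Q,
        forall w, L1 0%N w = L2 0%N w,
        forall x, independent_given Pr (L1 0%N @^-1` [set Some x]) L1 L2
      & has_law Pr (termination_time L1) (termination_time L2) mu]].

(* sum_{l < sigma} r(Z(l)); a terminated state, which does not occur before
   sigma almost surely, earns nothing. *)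
Definition total_reward (T : Type) (X : finType) (r : X -> nat)
    (Z : nat -> T -> option X) (w : T) : option nat :=
  omap (fun s => \sum_(l < s) oapp r 0%N (Z l w))%N (termination_time Z w).

Definition MDPHstar (R : realType) : set (bivariate_law R) :=
  [set mu | exists (X : finType) (a : X -> R) (Q : X -> X -> R)
      (r1 r2 : X -> nat)
      (d : measure_display) (T : measurableType d) (Pr : probability T R)
      (gamma : nat -> T -> option X),
    [/\ probability_vector a,
        subprobability_matrix Q,
        terminating_chain Pr gamma a Q
      & has_law Pr (total_reward r1 gamma) (total_reward r2 gamma) mu]].

(* Main.v *)
Require Import Defs.
From HB Require Import structures.
From mathcomp Require Import all_boot all_order all_algebra.
From mathcomp Require Import all_classical all_reals all_analysis.

Set Implicit Arguments.
Unset Strict Implicit.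
Unset Printing Implicit Defensive.

Import Order.TTheory GRing.Theory Num.Theory.

Local Open Scope classical_set_scope.
Local Open Scope ring_scope.

(** Both inclusions hold on the given probability space: from the processes that
witness membership in the smaller class, a pathwise construction yields
processes that witness membership in the larger one, so that no chain has to be
built from its transition matrix.

mDPH in CDPH.  Precede both chains by one time unit spent in an extra state:
[E] is a single point with [P = 0], [U] is the row [beta], and [Q1 = Q2 = Q].
The exit from [E] happens at time 1, at the common starting state of [L1] and
[L2], after which the two chains run independently with matrix [Q]
([delay_chain], [past_event_delay]).  Each termination time grows by exactly 1,
which the passage from support [N+2] to support [N+1] takes back.

CDPH in MDPH*.  Observe the pair [(M1, M2)].  While [M1] is in [E] the two
coordinates coincide and move together; afterwards they move independently.
Hence the pair is a Markov chain ([joint_markov]), and its kernel never revives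
a terminated coordinate.  Declare the pair terminated once both coordinates are
([kill], [markov_on_kill]), and let the reward [r_k] be 1 in the states where
the coordinate [k] is alive.  The killed chain ends at time
[max (tau_1, tau_2)], and up to then the coordinate [k] is alive at exactly
[tau_k] times ([total_reward_alive]).

The only probabilistic difficulty is [joint_markov].  Fix a path of the pair.
If the first coordinate is still in [E], either the path has left [E] before,
which is a null event, or the coordinates differ, which is impossible, or they
agree so far and the Markov property of [M1] suffices.  If the first coordinate
left [E] at time [t], condition on the past event [B] up to [t]: conditional
independence reads
[Pr (B, A1, A2) * Pr B = Pr (B, A1) * Pr (B, A2)], both factors on the right
extend by one step through their own Markov property, and [Pr B] cancels
([cancel_conditioning]).

That terminated coordinates stay terminated holds only almost surely: a Markov
chain with finitely many states almost surely never performs a step of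
probability zero ([ae_no_zero_step]).  Hence the termination times and rewards
on the two sides agree almost everywhere, which is enough for their laws
([has_law_ae]). *)

(** * First times and finite paths *)

Lemma first_timeP (p : pred nat) (n : nat) :
  first_time p = Some n <->
  [/\ (0 < n)%N, p n & forall m, (0 < m < n)%N -> ~~ p m].
Proof.
rewrite /first_time; case: pselect => [h|h]; last first.
  by split=> // -[n0 pn _]; case: h; exists n; rewrite n0.
case: ex_minnP => m /andP[m0 pm] mmin; split=> [[<-]|[n0 pn nmin]].
  split=> // k /andP[k0 km]; apply/negP => pk.
  by have := mmin k; rewrite k0 pk leqNgt km => /(_ isT).
congr Some; apply/eqP; rewrite eqn_leq mmin ?n0 //= leqNgt.
by apply/negP => mn; move: (nmin m); rewrite m0 mn pm => /(_ isT).
Qed.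

(** [path_event] for processes with values in an arbitrary type: the pair of two
processes is not of the form [option X]. *)
Definition path_in (T W : Type) (Z : nat -> T -> W) (n : nat) (x : nat -> W) :
    set T :=
  [set w | forall i, (i <= n)%N -> Z i w = x i].

Lemma path_inS (T W : Type) (Z : nat -> T -> W) (n : nat) (x : nat -> W) :
  path_in Z n.+1 x = path_in Z n x `&` Z n.+1 @^-1` [set x n.+1].
Proof.
apply/seteqP; split=> w /= => [h|[h hn] i].
  by split=> [i ilen|]; apply: h; rewrite ?leqnn // leqW.
by rewrite leq_eqVlt => /predU1P[->//|]; rewrite ltnS; exact: h.
Qed.

Lemma path_in0 (T W : Type) (Z : nat -> T -> W) (x : nat -> W) :
  path_in Z 0 x = Z 0%N @^-1` [set x 0%N].
Proof.
by apply/seteqP; split=> w /= => [|h i]; [apply | rewrite leqn0 => /eqP->].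
Qed.

Lemma path_in_eq (T W : Type) (Z : nat -> T -> W) (n : nat) (x y : nat -> W) :
  (forall i, (i <= n)%N -> x i = y i) -> path_in Z n x = path_in Z n y.
Proof.
by move=> xy; apply/seteqP; split=> w h i ilen; rewrite h ?xy.
Qed.

(** [markov_given] for arbitrary values, with the last step absorbed into the
path; on [option X] the two notions agree by [markov_givenP]. *)
Definition markov_on d (T : measurableType d) (R : realType)
    (P : probability T R) (W : Type) (B : set T) (Z : nat -> T -> W)
    (G : W -> W -> R) : Prop :=
  forall n x, (P (B `&` path_in Z n.+1 x) =
               P (B `&` path_in Z n x) * (G (x n) (x n.+1))%:E)%E.

(** A path of length [n] and a next value [y] form a path of length [n.+1]. *)
Lemma markov_givenP d (T : measurableType d) (R : realType)
    (P : probability T R) (X : finType) (B : set T)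
    (Z : nat -> T -> option X) (Q : X -> X -> R) :
  markov_given P B Z Q <-> markov_on P B Z (transition Q).
Proof.
split=> [h n x|h n x y]; first by rewrite path_inS setIA; exact: h.
pose x' i := if (i <= n)%N then x i else y.
have -> : path_event Z n x = path_in Z n x'.
  by apply: path_in_eq => i ilen; rewrite /x' ilen.
have := h n x'; rewrite path_inS setIA /x' leqnn ltnn; exact.
Qed.

(** * Processes with finitely many values *)

Section FiniteProcess.
Context {d} {T : measurableType d} {R : realType} (P : probability T R).
Variables (W : finType) (Z : nat -> T -> W).
Hypothesis mZ : forall n x, measurable (Z n @^-1` [set x]).

Lemma measurable_path (n : nat) (x : nat -> W) : measurable (path_in Z n x).
Proof.
elim: n => [|n IHn]; first by rewrite path_in0.
by rewrite path_inS; apply: measurableI.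
Qed.

(** A condition [D] on the values up to time [n] splits into finitely many path
events, one for each word of length [n.+1]; this reduces the measurability and
the nullity of the event to those of paths. *)
Lemma cylinder_words (n : nat) (D : (nat -> W) -> Prop) :
  (forall x y, (forall i, (i <= n)%N -> x i = y i) -> D x -> D y) ->
  [set w | D (Z^~ w)] =
  \big[setU/set0]_(f : {ffun 'I_n.+1 -> W} | `[< D (fun i => f (inord i)) >])
    path_in Z n (fun i => f (inord i)).
Proof.
move=> Dn; rewrite -bigcup_pred; apply/seteqP; split=> w /= => [Dw|[f]].
  exists [ffun i : 'I_n.+1 => Z i w] => /= [|i ilen].
    by apply/asboolP; apply: Dn Dw => i ilen; rewrite ffunE inordK.
  by rewrite ffunE inordK.
by move=> /= /asboolP Df fw; apply: Dn Df => i ilen; rewrite fw.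
Qed.

Lemma cylinder_measurable (n : nat) (D : (nat -> W) -> Prop) :
  (forall x y, (forall i, (i <= n)%N -> x i = y i) -> D x -> D y) ->
  measurable [set w | D (Z^~ w)].
Proof.
move=> /cylinder_words ->; apply: bigsetU_measurable => f _.
exact: measurable_path.
Qed.

Lemma cylinder_null (n : nat) (D : (nat -> W) -> Prop) :
  (forall x y, (forall i, (i <= n)%N -> x i = y i) -> D x -> D y) ->
  (forall x, D x -> P (path_in Z n x) = 0%E) ->
  P.-negligible [set w | D (Z^~ w)].
Proof.
move=> /cylinder_words -> D0.
elim/big_rec: _ => [|f B /asboolP Df]; first exact: negligible_set0.
apply: negligibleU; apply/negligibleP; first exact: measurable_path.
exact: D0.
Qed.

Lemma sum_prob_values (n : nat) : (\sum_x P (Z n @^-1` [set x]) = 1)%E.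
Proof.
rewrite fsbig_seq ?index_enum_uniq // -measure_fin_bigcup //=.
- rewrite -(@probability_setT _ _ _ P); congr (P _).
  by apply/seteqP; split=> // w _; exists (Z n w) => //=; rewrite mem_index_enum.
- by move=> x y _ _ [w [/= -> ->]].
Qed.

Variable G : W -> W -> R.
Hypothesis ZG : markov_on P setT Z G.

(** A path cannot be more likely than its initial segment that ends with the
forbidden step. *)
Lemma path_prob_zero (n i : nat) (x : nat -> W) :
  (i < n)%N -> G (x i) (x i.+1) = 0 -> P (path_in Z n x) = 0%E.
Proof.
move=> ltin G0; apply: (@subset_measure0 _ _ _ P _ (path_in Z i.+1 x)).
- exact: measurable_path.
- exact: measurable_path.
- by move=> w h j ji; apply: h; exact: leq_trans ji ltin.
- have p0 : P (path_in Z i.+1 x) = 0%E by have := ZG i x; rewrite !setTI G0 mule0.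
  exact: p0.
Qed.

(** For each [n], the words of length [n.+2] whose last step has probability zero
are null by [path_prob_zero], and they are finitely many. *)
Lemma ae_no_zero_step : {ae P, forall w, forall n, G (Z n w) (Z n.+1 w) <> 0}.
Proof.
apply: (@ae_foralln _ _ _ P (fun n w => G (Z n w) (Z n.+1 w) <> 0)) => n.
rewrite /almost_everywhere/= /prop_near1 /nbhs/=.
have := @cylinder_null n.+1 (fun x => ~ (G (x n) (x n.+1) <> 0)); apply.
  by move=> x y xy; rewrite !xy.
by move=> x /contrapT; apply: path_prob_zero.
Qed.

End FiniteProcess.

(** * Events and laws up to null sets *)

Lemma null_subset d (T : measurableType d) (R : realType)
    (P : probability T R) (A B : set T) :
  measurable A -> measurable B -> A `<=` B -> P B = 0%E -> P A = 0%E.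
Proof. by move=> mA mB AB B0; exact: (subset_measure0 mA mB AB B0). Qed.

Lemma measure_ae_eq d (T : measurableType d) (R : realType)
    (P : probability T R) (A B : set T) :
  measurable A -> measurable B -> {ae P, forall w, A w <-> B w} -> P A = P B.
Proof.
move=> mA mB [N [mN N0 AB]].
rewrite (measureDI P mA mN) (measureDI P mB mN).
have -> : A `\` N = B `\` N.
  apply/seteqP; split=> w [Aw /[dup] Nw /(contra_not (AB w))];
  by move=> /contrapT[? ?]; split=> //; auto.
have N1 C : measurable C -> P (C `&` N) = 0%E.
  by move=> mC; apply: null_subset N0 => //; exact: measurableI.
by congr (_ + _)%E; exact: etrans (N1 A mA) (esym (N1 B mB)).
Qed.

(** The components of the law are countable unions of joint level sets, so that
only the level sets [X = Some n] have to be measurable. *)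
Lemma has_law_ae d (T : measurableType d) (R : realType) (P : probability T R)
    (X Y X' Y' : T -> option nat) (mu : bivariate_law R) :
  (forall n, measurable (X @^-1` [set Some n])) ->
  (forall n, measurable (Y @^-1` [set Some n])) ->
  (forall n, measurable (X' @^-1` [set Some n])) ->
  (forall n, measurable (Y' @^-1` [set Some n])) ->
  {ae P, forall w, X w = X' w /\ Y w = Y' w} ->
  has_law P X Y mu -> has_law P X' Y' mu.
Proof.
move=> mX mY mX' mY' XY lawXY A mA; rewrite lawXY //.
have joint U V : (forall n, measurable (U @^-1` [set Some n])) ->
    (forall n, measurable (V @^-1` [set Some n])) ->
    measurable [set w : T | exists2 k : nat * nat,
      A k & U w = Some k.1 /\ V w = Some k.2].
  move=> mU mV.
  have -> : [set w | exists2 k, A k & U w = Some k.1 /\ V w = Some k.2] =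
      \bigcup_(k : nat * nat)
        (U @^-1` [set Some k.1] `&` V @^-1` [set Some k.2] `&` [set _ | A k]).
    apply/seteqP; split=> w /= [k]; first by move=> Ak UV; exists k.
    by move=> _ [UV Ak]; exists k.
  apply: countable_bigcupT_measurable => // k.
  apply: measurableI; first exact: measurableI.
  have [Ak|nAk] := pselect (A k).
    by rewrite (_ : [set _ | _] = setT) //; apply/seteqP; split.
  by rewrite (_ : [set _ | _] = set0) //; apply/seteqP; split.
apply: measure_ae_eq; [exact: joint | exact: joint |].
by apply: filterS XY => w [Xw Yw] /=; rewrite Xw Yw.
Qed.

Lemma measurable_termination_time d (T : measurableType d) (X : finType)
    (Z : nat -> T -> option X) (n : nat) :
  measurable_process Z -> measurable (termination_time Z @^-1` [set Some n]).
Proof.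
move=> mZ.
have := @cylinder_measurable _ _ _ Z mZ n
  (fun x => first_time (fun m => x m == None) = Some n); apply.
move=> x y xy /first_timeP[n0 xn nmin]; apply/first_timeP; split=> //.
  by rewrite -xy.
by move=> m /[dup] mn /nmin; rewrite xy //; case/andP: mn => _ /ltnW.
Qed.

Lemma measurable_omap_time d (T : measurableType d) (f : nat -> nat)
    (X : T -> option nat) (n : nat) :
  (forall m, measurable (X @^-1` [set Some m])) ->
  measurable ((fun w => omap f (X w)) @^-1` [set Some n]).
Proof.
move=> mX.
have -> : (fun w => omap f (X w)) @^-1` [set Some n] =
    \bigcup_(m in [set m | f m = n]) X @^-1` [set Some m].
  apply/seteqP; split=> w /=.
    by case Xw: (X w) => [m|] //= [<-]; exists m.
  by case=> m /= <- ->.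
by apply: bigcup_measurable => m _.
Qed.

(** On the event that the chain terminates at [s], the total reward depends on the
path up to [s] only. *)
Lemma measurable_total_reward d (T : measurableType d) (X : finType)
    (r : X -> nat) (Z : nat -> T -> option X) (n : nat) :
  measurable_process Z -> measurable (total_reward r Z @^-1` [set Some n]).
Proof.
move=> mZ.
have -> : total_reward r Z @^-1` [set Some n] =
    \bigcup_s (termination_time Z @^-1` [set Some s] `&`
      [set w | (\sum_(l < s) oapp r 0%N (Z l w))%N = n]).
  apply/seteqP; split=> w; rewrite /total_reward /=.
    by case Zw: (termination_time Z w) => [s|] //= [<-]; exists s.
  by case=> s _ /= [-> <-].
apply: bigcupT_measurable => s; apply: measurableI.
  exact: measurable_termination_time.
have := @cylinder_measurable _ _ _ Z mZ s
  (fun x => (\sum_(l < s) oapp r 0%N (x l))%N = n); apply.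
by move=> x y xy <-; apply: eq_bigr => i _; rewrite xy // ltnW.
Qed.

Lemma sum_option (V : nmodType) (X : finType) (F : option X -> V) :
  \sum_z F z = F None + \sum_x F (Some x).
Proof.
rewrite (bigD1 None) //=; congr (_ + _).
rewrite (reindex_omap Some id) //=; last by case.
by apply: eq_bigl => x; rewrite eqxx.
Qed.

(** The initial probabilities of the living states already sum to 1. *)
Lemma start_alive_null d (T : measurableType d) (R : realType)
    (P : probability T R) (X : finType) (Z : nat -> T -> option X)
    (a : X -> R) (Q : X -> X -> R) :
  probability_vector a -> terminating_chain P Z a Q ->
  P (Z 0%N @^-1` [set None]) = 0%E.
Proof.
move=> [_ a1] [mZ Z0 _ _]; have := sum_prob_values P mZ 0.
rewrite sum_option (eq_bigr _ (fun x _ => Z0 x)) sumEFin a1.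
have fP : P (Z 0%N @^-1` [set None]) \is a fin_num by exact: fin_num_measure.
rewrite -(fineK fP) -EFinD => -[p1]; congr (_%:E).
by apply: (addIr 1); rewrite add0r.
Qed.

Lemma ae_start_alive d (T : measurableType d) (R : realType)
    (P : probability T R) (X : finType) (Z : nat -> T -> option X)
    (a : X -> R) (Q : X -> X -> R) :
  probability_vector a -> terminating_chain P Z a Q ->
  {ae P, forall w, Z 0%N w <> None}.
Proof.
move=> pa cZ; have [mZ _ _ _] := cZ.
exists (Z 0%N @^-1` [set None]); split; first exact: mZ.
  exact: start_alive_null pa cZ.
by move=> w /= /contrapT.
Qed.

(** * Relabelling the states *)

Section Embedding.
Context (T V W : Type) (f : V -> W) (g : W -> V).
Hypothesis fK : cancel f g.

Lemma path_in_embedding (Z : nat -> T -> V) (n : nat) (x : nat -> W) :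
  path_in (fun i w => f (Z i w)) n x =
  path_in Z n (g \o x) `&` [set _ | forall i, (i <= n)%N -> f (g (x i)) = x i].
Proof.
apply/seteqP; split=> w /= => [h|[h fg] i ilen]; last by rewrite h //= fg.
by split=> i ilen /=; rewrite -h // fK.
Qed.

Lemma path_in_range (Z : nat -> T -> V) (n : nat) (x : nat -> W) :
  (forall i, (i <= n)%N -> f (g (x i)) = x i) ->
  path_in (fun i w => f (Z i w)) n x = path_in Z n (g \o x).
Proof. by move=> fg; rewrite path_in_embedding; apply/setIidPl => w _. Qed.

Lemma path_in_off_range (Z : nat -> T -> V) (n : nat) (x : nat -> W) :
  ~ (forall i, (i <= n)%N -> f (g (x i)) = x i) ->
  path_in (fun i w => f (Z i w)) n x = set0.
Proof.
by move=> nfg; rewrite path_in_embedding; apply/seteqP; split=> w // -[_ /nfg].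
Qed.

End Embedding.

(** A path of the relabelled process either stays in the range of [f], and then is
a path of [Z], or leaves it, and then is impossible; [H] has to assign
probability zero to the step by which it leaves. *)
Lemma markov_on_embedding d (T : measurableType d) (R : realType)
    (P : probability T R) (V W : Type) (f : V -> W) (g : W -> V) (B : set T)
    (Z : nat -> T -> V) (G : V -> V -> R) (H : W -> W -> R) :
  cancel f g -> (forall v v', H (f v) (f v') = G v v') ->
  (forall v y, f (g y) <> y -> H (f v) y = 0) ->
  markov_on P B Z G -> markov_on P B (fun n w => f (Z n w)) H.
Proof.
move=> fK HG H0 ZG n x.
have [fg|nfg] := pselect (forall i, (i <= n)%N -> f (g (x i)) = x i); last first.
  rewrite !(path_in_off_range fK) // ?setI0 ?measure0 ?mul0e //.
  by move=> fg; apply: nfg => i ilen; apply: fg; exact: leqW.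
have [fgn|nfgn] := pselect (f (g (x n.+1)) = x n.+1).
  rewrite !(path_in_range fK) // => [|i]; last first.
    by rewrite leq_eqVlt => /predU1P[->//|]; exact: fg.
  by rewrite ZG /= -(HG (g (x n))) fg // fgn.
rewrite (path_in_off_range fK _ (n := n.+1)) => [|fgS]; last exact/nfgn/fgS.
by rewrite setI0 measure0 -(fg n) // H0 // mule0.
Qed.

Lemma independent_given_embedding d (T : measurableType d) (R : realType)
    (P : probability T R) (X Y X' Y' : finType) (f : option X -> option X')
    (f' : option X' -> option X) (g : option Y -> option Y')
    (g' : option Y' -> option Y) (B : set T)
    (Z1 : nat -> T -> option X) (Z2 : nat -> T -> option Y) :
  cancel f f' -> cancel g g' ->
  independent_given P B Z1 Z2 ->
  independent_given P B (fun n w => f (Z1 n w)) (fun n w => g (Z2 n w)).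
Proof.
move=> fK gK ind m n x y; rewrite /path_event -!/(path_in _ _ _).
have [fx|nfx] := pselect (forall i, (i <= m)%N -> f (f' (x i)) = x i); last first.
  by rewrite !(path_in_off_range fK _ nfx) !(setI0, set0I) measure0 !mul0e.
have [gy|ngy] := pselect (forall i, (i <= n)%N -> g (g' (y i)) = y i); last first.
  by rewrite !(path_in_off_range gK _ ngy) !(setI0, set0I) measure0 mul0e mule0.
by rewrite !(path_in_range fK _ fx) !(path_in_range gK _ gy); exact: ind.
Qed.

(** A path prescribes the value at time 0, so that conditioning on that value
either changes nothing or leaves the empty event. *)
Lemma markov_on_start d (T : measurableType d) (R : realType)
    (P : probability T R) (W : Type) (Z : nat -> T -> W) (G : W -> W -> R)
    (z : W) :
  markov_on P setT Z G -> markov_on P (Z 0%N @^-1` [set z]) Z G.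
Proof.
move=> ZG n x; have := ZG n x; rewrite !setTI.
have start m : Z 0%N @^-1` [set z] `&` path_in Z m x =
    if `[< x 0%N = z >] then path_in Z m x else set0.
  case: asboolP => xz; apply/seteqP; split=> w //=; first by case.
    by move=> h; split=> //; rewrite -xz; apply: h.
  by case=> Zz h; apply: xz; rewrite -h.
by rewrite !start; case: ifP => // _ _; rewrite measure0 mul0e.
Qed.

(** * The class mDPH: one time unit before the common start *)

Definition in_right (X Y : finType) (z : option (Y + X)) : option X :=
  if z is Some (inr x) then Some x else None.

Lemma omap_inrK (X Y : finType) :
  cancel (omap inr) (@in_right X Y).
Proof. by case. Qed.

Section Delay.
Context (X : finType) (T : Type).

(** The single extra state [inl tt] plays the role of [E]. *)
Definition delay (L : nat -> T -> option X) (n : nat) (w : T) :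
    option (unit + X) :=
  if n is m.+1 then omap inr (L m w) else Some (inl tt).

Lemma exit_time_delay (L : nat -> T -> option X) (w : T) :
  exit_time (delay L) w = Some 1%N.
Proof.
apply/first_timeP; split=> //=; first by case: (L 0%N w).
by case.
Qed.

(** If [L] were terminated at time 0, its termination time would still be at least
1, while the delayed process would terminate at time 1. *)
Lemma termination_time_delay (L : nat -> T -> option X) (w : T) (n : nat) :
  L 0%N w <> None -> termination_time L w = Some n ->
  termination_time (delay L) w = Some n.+1.
Proof.
move=> L0 /first_timeP[n0 /eqP Ln nmin]; apply/first_timeP; split=> //=.
  by rewrite Ln.
move=> [//|[|m]] /=; first by case: (L 0%N w) L0.
by move=> mn; have := nmin m.+1 mn; case: (L _ w).
Qed.

(** The past of the delayed chain up to its exit from [E] reveals nothing but the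
starting state of [L]. *)
Lemma past_event_delay (L : nat -> T -> option X) (t : nat)
    (h : nat -> option (unit + X)) :
  past_event (delay L) t h = set0 \/
  t = 1%N /\ past_event (delay L) t h = L 0%N @^-1` [set in_right (h 1%N)].
Proof.
have [t1|nt1] := eqVneq t 1%N; last first.
  left; apply/seteqP; split=> w // -[/=]; rewrite exit_time_delay => -[t1].
  by rewrite t1 eqxx in nt1.
rewrite t1.
have [[h0 h1]|nh] := pselect (h 0%N = Some (inl tt) /\
    omap inr (in_right (h 1%N)) = h 1%N).
  right; split=> //; apply/seteqP; split=> w; rewrite /past_event /=.
    by move=> [_ hw]; rewrite -(hw 1%N) //= omap_inrK.
  move=> Lw; split; first exact: exit_time_delay.
  by case=> [|[|//]] _ /=; rewrite ?h0 // Lw.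
left; apply/seteqP; split=> w // -[_ hw]; apply: nh.
by rewrite -(hw 0%N) // -(hw 1%N) //= omap_inrK.
Qed.

End Delay.

(** From [X] the set [Y] is never entered, so that the padded matrix loses the
same row mass as [Q]. *)
Lemma transition_inr (R : realType) (X Y : finType) (A : Y -> Y -> R)
    (B : Y -> X -> R) (Q : X -> X -> R) (x y : option X) :
  transition (block_matrix A B (fun _ _ => 0) Q) (omap inr x) (omap inr y) =
  transition Q x y.
Proof. by case: x y => [x|] [y|] //=; rewrite big_sumType /= big1 // add0r. Qed.

Lemma markov_on_inr d (T : measurableType d) (R : realType)
    (P : probability T R) (X Y : finType) (A : Y -> Y -> R)
    (C : Y -> X -> R) (Q : X -> X -> R) (B : set T) (Z : nat -> T -> option X) :
  markov_on P B Z (transition Q) ->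
  markov_on P B (fun n w => omap inr (Z n w) : option (Y + X))
    (transition (block_matrix A C (fun _ _ => 0) Q)).
Proof.
apply: (markov_on_embedding (@omap_inrK X Y)); first exact: transition_inr.
by move=> [x|] [[y|y]|].
Qed.

Section DelayChain.
Context d (T : measurableType d) (R : realType) (P : probability T R).
Context (X : finType) (beta : X -> R) (Q : X -> X -> R).
Variables (L : nat -> T -> option X).
Hypothesis pbeta : probability_vector beta.
Hypothesis chainL : terminating_chain P L beta Q.

Lemma measurable_delay : measurable_process (delay L).
Proof.
have [mL _ _ _] := chainL; move=> [|n] x /=.
  by rewrite preimage_cst; case: ifP.
have -> : delay L n.+1 @^-1` [set x] =
    if `[< omap inr (in_right x) = x >] then L n @^-1` [set in_right x] else set0.
  case: asboolP => [xr|nxr]; apply/seteqP; split=> w //=.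
  - by move=> <-; rewrite omap_inrK.
  - by move=> ->.
  - by move=> xL; apply: nxr; rewrite -xL omap_inrK.
by case: ifP.
Qed.

Lemma terminates_delay : terminates_as P (delay L).
Proof.
have [_ _ _ tL] := chainL.
apply: filterS2 (ae_start_alive pbeta chainL) tL => w L0 [n Ln].
by exists n.+1; exact: termination_time_delay.
Qed.

Lemma ae_termination_delay :
  {ae P, forall w, termination_time L w =
    omap (fun n => (n - 1)%N) (termination_time (delay L) w)}.
Proof.
have [_ _ _ tL] := chainL.
apply: filterS2 (ae_start_alive pbeta chainL) tL => w L0 [n Ln].
by rewrite (termination_time_delay L0 Ln) Ln /= subn1.
Qed.

Lemma delay_chain :
  terminating_chain P (delay L) (block_vector (fun _ => 1) (fun _ => 0))
    (block_matrix (fun _ _ => 0) (fun _ => beta) (fun _ _ => 0) Q).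
Proof.
have [mL L0 ML _] := chainL; have [b0 b1] := pbeta.
split; [exact: measurable_delay| | |exact: terminates_delay].
  move=> [[]|x] /=.
    by rewrite -(@probability_setT _ _ _ P); congr (P _); apply/seteqP; split.
  by rewrite (_ : _ @^-1` _ = set0) ?measure0 //; apply/seteqP; split.
apply/markov_givenP => n x; rewrite !setTI.
have [x0|nx0] := pselect (x 0%N = Some (inl tt)); last first.
  have empty m : path_in (delay L) m x = set0.
    by apply/seteqP; split=> w // /(_ 0%N isT) /= /esym.
  by rewrite !empty measure0 mul0e.
have shift m : path_in (delay L) m.+1 x =
    path_in (fun i w => omap inr (L i w)) m (fun i => x i.+1).
  apply/seteqP; split=> w h; first by move=> i im; exact: (h i.+1).
  by case=> [_|i im]; [rewrite x0 | exact: h].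
(* the first step draws the starting state of [L], later ones are steps of [L] *)
case: n => [|n]; last first.
  have /markov_givenP/markov_on_inr := ML.
  move=> /(_ unit (fun _ _ => 0) (fun _ => beta)) /(_ n (fun i => x i.+1)).
  by rewrite !setTI !shift.
rewrite shift.
have -> : path_in (delay L) 0 x = setT.
  by apply/seteqP; split=> w // _ i; rewrite leqn0 => /eqP ->; rewrite x0.
rewrite probability_setT mul1e path_in0 x0.
case: (x 1%N) => [[[]|s]|] /=.
- rewrite (_ : _ @^-1` _ = set0) ?measure0 //; apply/seteqP; split=> w //=.
  by case: (L 0%N w).
- rewrite -L0; congr (P _); apply/seteqP.
  by split=> w /=; case: (L 0%N w) => //= ? [->].
- rewrite big_sumType /= big1 // add0r b1 subrr.
  rewrite (_ : _ @^-1` _ = L 0%N @^-1` [set None]); last first.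
    by apply/seteqP; split=> w /=; case: (L 0%N w).
  exact: start_alive_null pbeta chainL.
Qed.

End DelayChain.

Lemma mDPH_sub_CDPH_1 (R : realType) : @mDPH R `<=` @CDPH_1 R.
Proof.
move=> mu [X [beta [Q [d [T [P [L1 [L2 [[pb sQ]]]]]]]]]].
move=> [c1 c2 L0 ind law].
exists unit, X, (fun _ => 1), (fun _ _ => 0), (fun _ => beta), Q, Q.
exists d, T, P, (delay L1), (delay L2); split.
- have [b0 b1] := pb; split; first by rewrite card_unit.
  split.
    rewrite lt0n; apply/negP => /eqP X0; move: b1; rewrite big_pred0.
      by move/eqP; rewrite eq_sym oner_eq0.
    by move=> x; have := card0_eq X0 x; rewrite inE.
  do 5?split => //.
  + by rewrite big_const card_unit /= addr0.
  + by move=> _; rewrite big1.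
  + by move=> _; rewrite big1 // add0r.
- split; first exact: delay_chain.
  split; first exact: measurable_delay c2.
  split.
    move=> n w; rewrite exit_time_delay; case: n => [//|[|//]] _ /=.
    by rewrite L0.
  split.
    move=> t h; apply/markov_givenP.
    have [->|[-> ->]] := past_event_delay L1 t h.
      by move=> n x; rewrite !set0I measure0 mul0e.
    rewrite (_ : L1 0%N = L2 0%N); last exact/funext.
    apply: markov_on_inr; apply: markov_on_start.
    by have [_ _ /markov_givenP] := c2.
  split; last exact: terminates_delay c2.
  move=> t h m n x y.
  have [->|[-> ->]] := past_event_delay L1 t h.
    by rewrite !set0I measure0 !mul0e.
  apply: (independent_given_embedding (@omap_inrK X unit) (@omap_inrK X unit)).
  (* independence is given for living starting states; the other one is null *)
  case: (in_right _) => [z|]; first exact: ind.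
  have B0 A : measurable A -> P (L1 0%N @^-1` [set None] `&` A) = 0%E.
    move=> mA; have [m1 _ _ _] := c1.
    apply: (null_subset _ (m1 0%N None)) => [|w []//|].
      exact: measurableI.
    exact: start_alive_null pb c1.
  have [[m1 _ _ _] [m2 _ _ _]] := (c1, c2).
  move=> {}m {}n {}x {}y; rewrite -setIA !B0 ?mul0e //; try exact: measurable_path.
  by apply: measurableI; exact: measurable_path.
- have [[m1 _ _ _] [m2 _ _ _]] := (c1, c2).
  apply: has_law_ae law => [n|n|n|n|].
  + exact: measurable_termination_time.
  + exact: measurable_termination_time.
  + apply: measurable_omap_time => k; apply: measurable_termination_time.
    exact: measurable_delay c1.
  + apply: measurable_omap_time => k; apply: measurable_termination_time.
    exact: measurable_delay c2.
  + by apply: filterS2 (ae_termination_delay pb c1) (ae_termination_delay pb c2).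
Qed.

(** * Merging an absorbing state with termination *)

Lemma transition_ge0 (R : realType) (X : finType) (Q : X -> X -> R) :
  subprobability_matrix Q -> forall x y, 0 <= transition Q x y.
Proof. by move=> [Q0 Q1] [x|] [y|] //=; rewrite subr_ge0. Qed.

Lemma sum_transition (R : realType) (X : finType) (Q : X -> X -> R)
    (x : option X) :
  \sum_y transition Q x y = 1.
Proof.
rewrite sum_option; case: x => [x|] /=; first by rewrite subrK.
by rewrite big1 // addr0.
Qed.

Lemma subprobability_block (R : realType) (X Y : finType) (A : X -> X -> R)
    (B : X -> Y -> R) (C : Y -> X -> R) (D : Y -> Y -> R) :
  (forall x x', 0 <= A x x') -> (forall x y, 0 <= B x y) ->
  (forall y x, 0 <= C y x) -> (forall y y', 0 <= D y y') ->
  (forall x, \sum_x' A x x' + \sum_y B x y <= 1) ->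
  (forall y, \sum_x C y x + \sum_y' D y y' <= 1) ->
  subprobability_matrix (block_matrix A B C D).
Proof.
move=> A0 B0 C0 D0 AB CD; split; first by move=> [x|y] [x'|y'] /=.
by move=> [x|y]; rewrite big_sumType /=.
Qed.

Section Killing.
Context (R : realType) (W : finType) (o : W).

Definition kill (T : Type) (Z : nat -> T -> W) (n : nat) (w : T) : option W :=
  if Z n w == o then None else Some (Z n w).

Definition kill_matrix (G : W -> W -> R) (x y : W) : R :=
  if y == o then 0 else G x y.

Variable G : W -> W -> R.
Hypotheses (G_ge0 : forall x y, 0 <= G x y) (G_sum : forall x, \sum_y G x y = 1).

Lemma sum_kill_matrix (x : W) : \sum_y kill_matrix G x y = 1 - G x o.
Proof.
rewrite -(G_sum x) [in RHS](bigD1 o) //= addrAC subrr add0r.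
rewrite (bigD1 o) //= {1}/kill_matrix eqxx add0r.
by apply: eq_bigr => y /negbTE yo; rewrite /kill_matrix yo.
Qed.

Lemma subprobability_kill : subprobability_matrix (kill_matrix G).
Proof.
split=> [x y|x]; first by rewrite /kill_matrix; case: ifP.
by rewrite sum_kill_matrix gerBl.
Qed.

Hypothesis G_absorbing : forall y, G o y = (y == o)%:R.

(** Termination of the killed process stands for [o], and both are absorbing: away
from [Some o], which is never entered, the killed chain steps like [G]. *)
Lemma transition_kill (u v : option W) :
  transition (kill_matrix G) u v =
  if v == Some o then 0 else G (odflt o u) (odflt o v).
Proof.
have [->|vo] := eqVneq v (Some o).
  by case: u => [x|] //=; rewrite /kill_matrix eqxx.
case: u v vo => [x|] [y|] //= vo; last by rewrite G_absorbing eqxx.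
- by rewrite /kill_matrix (_ : (y == o) = false) //; apply: contraNF vo => /eqP ->.
- by rewrite sum_kill_matrix subKr.
- by rewrite G_absorbing (_ : (y == o) = false) //; apply: contraNF vo => /eqP ->.
Qed.

(** [odflt o] undoes the killing, except at the value [Some o], which the killed
process never takes because it reports [o] as [None]. *)
Lemma path_in_kill (T : Type) (Z : nat -> T -> W) (n : nat)
    (x : nat -> option W) :
  path_in (kill Z) n x =
  path_in Z n (odflt o \o x) `&` [set _ | forall i, (i <= n)%N -> x i <> Some o].
Proof.
apply/seteqP; split=> w /= => [h|[h xo] i ilen].
  split=> i ilen /=; rewrite -h // /kill; case: eqP => //= Zo.
  by case.
rewrite /kill h //=; move: (xo i ilen); case: (x i) => [y|] /=; last by rewrite eqxx.
by case: eqP => // ->.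
Qed.

Lemma markov_on_kill d (T : measurableType d) (P : probability T R) (B : set T)
    (Z : nat -> T -> W) :
  markov_on P B Z G -> markov_on P B (kill Z) (transition (kill_matrix G)).
Proof.
move=> ZG n x; rewrite !path_in_kill.
have [xo|xo] := pselect (forall i, (i <= n)%N -> x i <> Some o); last first.
  rewrite (_ : [set _ | forall i, (i <= n)%N -> _] = set0); last first.
    by apply/seteqP; split.
  rewrite (_ : [set _ | _] = set0); last first.
    apply/seteqP; split=> // w /= h; apply: xo => i ilen; apply: h.
    exact: leqW.
  by rewrite !setI0 measure0 mul0e.
rewrite (_ : [set _ | forall i, (i <= n)%N -> _] = setT); last first.
  by apply/seteqP; split.
rewrite setIT transition_kill; case: eqP => xS.
  rewrite (_ : [set _ | _] = set0); last first.
    by apply/seteqP; split=> // w /= h; exact: h xS.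
  by rewrite !setI0 measure0 mule0.
rewrite (_ : [set _ | _] = setT); last first.
  apply/seteqP; split=> // w _ i; rewrite leq_eqVlt => /predU1P[->//|].
  exact: xo.
by rewrite setIT; exact: ZG.
Qed.

Lemma measurable_kill d (T : measurableType d) (Z : nat -> T -> W) :
  (forall n x, measurable (Z n @^-1` [set x])) -> measurable_process (kill Z).
Proof.
move=> mZ n x.
have := @cylinder_measurable _ _ _ Z mZ n
  (fun z => (if z n == o then None else Some (z n)) = x); apply.
by move=> z z' zz'; rewrite zz'.
Qed.

End Killing.

(** * The pair of coupled chains *)

Lemma le_first_time (p : pred nat) (n : nat) :
  (forall i, (0 < i < n)%N -> ~~ p i) -> le_time n (first_time p).
Proof.
move=> pn; case pk: (first_time p) => [k|] //=; move/first_timeP: pk => [k0 pk _].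
by rewrite leqNgt; apply/negP => kn; move: (pn k); rewrite k0 kn pk => /(_ isT).
Qed.

(** With [p] the probability of the conditioning event, this turns two instances
of conditional independence, before and after a step with probabilities [g]
and [h], into the Markov property of the pair; for [p = 0] all events involved
are null. *)
Lemma cancel_conditioning (R : realType) (p a a' b c : \bar R) (g h : R) :
  p \is a fin_num -> a \is a fin_num -> a' \is a fin_num ->
  b \is a fin_num -> c \is a fin_num ->
  (p = 0 -> a = 0)%E -> (p = 0 -> a' = 0)%E ->
  (a * p = b * c)%E -> (a' * p = (b * g%:E) * (c * h%:E))%E ->
  (a' = a * (g * h)%:E)%E.
Proof.
case: p a a' b c => [p||] // [a||] // [a'||] // [b||] // [c||] // _ _ _ _ _.
have [->|p0] := eqVneq p 0; first by move=> -> // -> // _ _; rewrite mul0e.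
move=> _ _; rewrite -!EFinM => -[ap] -[a'p]; congr (_%:E).
by apply: (mulIf p0); rewrite a'p mulrACA -ap mulrAC.
Qed.

Section JointChain.
Context (R : realType) (E S : finType) (alpha : E -> R) (P : E -> E -> R)
  (U : E -> S -> R) (Q1 Q2 : S -> S -> R) (d : measure_display)
  (T : measurableType d) (Pr : probability T R)
  (M1 M2 : nat -> T -> option (E + S)).
Hypotheses (params : cdph_parameters alpha P U Q1 Q2)
  (chains : cdph_chains alpha P U Q1 Q2 Pr M1 M2).

Let K1 := block_matrix P U (fun _ _ => 0) Q1.
Let K2 : E + S -> E + S -> R :=
  block_matrix (fun _ _ => 0) (fun _ _ => 0) (fun _ _ => 0) Q2.

Definition joint (n : nat) (w : T) : option (E + S) * option (E + S) :=
  (M1 n w, M2 n w).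

(** The coupled motion applies only when the two coordinates coincide in [E].  On
the unreachable states with distinct coordinates, the first one in [E], the
product form is chosen because it keeps a terminated coordinate terminated,
which makes this property a consequence of [ae_no_zero_step]. *)
Definition joint_kernel (z z' : option (E + S) * option (E + S)) : R :=
  if in_left z.1 && (z.1 == z.2)
  then if z'.1 == z'.2 then transition K1 z.1 z'.1 else 0
  else transition K1 z.1 z'.1 * transition K2 z.2 z'.2.

Lemma block_probability_vector :
  probability_vector (block_vector alpha (fun _ : S => 0)).
Proof.
have [_ [_ [[a0 a1] _]]] := params; split=> [[x|y] //=|].
by rewrite big_sumType /= a1 big1 // addr0.
Qed.

Lemma subprobability_K1 : subprobability_matrix K1.
Proof.
have [_ [_ [_ [[P0 _] [U0 [PU [[q0 q1] _]]]]]]] := params.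
apply: subprobability_block => // [x|y]; first by rewrite PU.
by rewrite big1 // add0r.
Qed.

Lemma subprobability_K2 : subprobability_matrix K2.
Proof.
have [_ [_ [_ [_ [_ [_ [_ [q0 q1]]]]]]]] := params.
by apply: subprobability_block => // [x|y]; rewrite big1 // add0r // big1.
Qed.

Lemma joint_kernel_ge0 z z' : 0 <= joint_kernel z z'.
Proof.
have t1 := transition_ge0 subprobability_K1.
have t2 := transition_ge0 subprobability_K2.
by rewrite /joint_kernel; case: ifP => _; [case: ifP | apply: mulr_ge0].
Qed.

Lemma sum_joint_kernel z : \sum_z' joint_kernel z z' = 1.
Proof.
rewrite -(pair_bigA _ (fun x y => joint_kernel z (x, y))) /=.
rewrite /joint_kernel /=; case: (in_left z.1 && (z.1 == z.2)).
  rewrite -(sum_transition K1 z.1); apply: eq_bigr => x _.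
  by rewrite -big_mkcond (big_pred1 x) // => y /=; rewrite eq_sym.
under eq_bigr do rewrite -big_distrr /= sum_transition mulr1.
exact: sum_transition.
Qed.

Lemma measurable_joint n z : measurable (joint n @^-1` [set z]).
Proof.
have [[m1 _ _ _] [m2 _]] := chains.
rewrite (_ : _ @^-1` _ = M1 n @^-1` [set z.1] `&` M2 n @^-1` [set z.2]).
  exact: measurableI.
apply/seteqP; split=> w /=; first by move=> <-.
by rewrite /joint; case: z => x y /= [-> ->].
Qed.

Lemma path_in_joint n z :
  path_in joint n z =
  path_in M1 n (fst \o z) `&` path_in M2 n (snd \o z).
Proof.
apply/seteqP; split=> w /= => [h|[h1 h2] i ilen].
  by split=> i ilen /=; rewrite -h.
by rewrite /joint h1 // h2 //=; case: (z i).
Qed.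

(** The exit time is not reached before [n], and up to the exit time both
processes agree; the value at time [n] itself may lie outside [E]. *)
Lemma agree_in_left n w :
  (forall i, (0 < i < n)%N -> in_left (M1 i w)) ->
  forall i, (i <= n)%N -> M2 i w = M1 i w.
Proof.
have [_ [_ [agree _]]] := chains => left i ilen; apply: agree.
apply: le_first_time => j /andP[j0 ji]; rewrite negbK left // j0.
exact: leq_trans ji ilen.
Qed.

(** The first matrix has a zero block below [P]: once outside, [M1] cannot return
to [E], and somewhere between [i] and [n] the path would have to. *)
Lemma reenter_left_null n i (x : nat -> option (E + S)) :
  (i <= n)%N -> ~~ in_left (x i) -> in_left (x n) ->
  Pr (path_in M1 n x) = 0%E.
Proof.
have [[m1 _ /markov_givenP ML _] _] := chains.
move=> + nxi; elim: n => [|n IHn].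
  by rewrite leqn0 => /eqP i0; move: nxi; rewrite i0 => /negbTE ->.
rewrite leq_eqVlt => /predU1P[in1 xn|ilen xn].
  by rewrite -in1 (negbTE nxi) in xn.
have [xnl|xnr] := boolP (in_left (x n)).
  apply: null_subset (IHn ilen xnl); try exact: measurable_path.
  by rewrite path_inS; exact: subIsetl.
apply: (path_prob_zero m1 ML (leqnn n.+1)).
by move: xn xnr; rewrite -/K1; case: (x n.+1) => [[]|] //; case: (x n) => [[]|].
Qed.

Lemma start_left_null x : ~~ in_left x -> Pr (M1 0%N @^-1` [set x]) = 0%E.
Proof.
have [c1 _] := chains; have [_ M0 _ _] := c1.
case: x => [[//|s]|] _; first by rewrite M0.
exact: start_alive_null block_probability_vector c1.
Qed.

(** The case distinction follows the first coordinate of the prescribed path [z]: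
still in [E] at time [n], or outside since its first exit [t].  Paths whose
coordinates differ before or at the exit are impossible by the definition of
[M2]. *)
Lemma joint_markov : markov_on Pr setT joint joint_kernel.
Proof.
have [[m1 _ /markov_givenP ML _] [m2 [agree [M2L [ind _]]]]] := chains.
move=> n z; rewrite !setTI.
have mj k y : measurable (path_in joint k y).
  by apply: measurable_path; exact: measurable_joint.
pose x := fst \o z; pose y := snd \o z.
have null_case : Pr (path_in M1 n x) = 0%E ->
    Pr (path_in joint n.+1 z) = (Pr (path_in joint n z) *
      (joint_kernel (z n) (z n.+1))%:E)%E.
  move=> x0.
  have -> : Pr (path_in joint n z) = 0%E.
    apply: null_subset x0 => //; first exact: measurable_path.
    by rewrite path_in_joint; exact: subIsetl.
  rewrite mul0e; apply: null_subset x0 => //; first exact: measurable_path.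
  by rewrite path_inS path_in_joint => w [[]].
have [xnl|xnr] := boolP (in_left (x n)).
  have [allleft|] := pselect (forall i, (i <= n)%N -> in_left (x i)); last first.
    move=> /existsNP[i /not_implyP[ilen /negP nxi]].
    exact/null_case/(reenter_left_null ilen nxi xnl).
  have same w : path_in M1 n x w -> forall i, (i <= n.+1)%N -> M2 i w = M1 i w.
    move=> xw; apply: agree_in_left => i /andP[_ ilen].
    by rewrite xw // allleft.
  have [xy|nxy] := pselect (forall i, (i <= n)%N -> x i = y i); last first.
    have e0 : path_in joint n z = set0.
      rewrite path_in_joint; apply/seteqP; split=> // w [xw yw]; apply: nxy.
      move=> i ilen; have := same w xw i (leqW ilen).
      by rewrite xw // yw.
    by rewrite path_inS e0 set0I measure0 mul0e.
  have jn : path_in joint n z = path_in M1 n x.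
    rewrite path_in_joint; apply/seteqP; split=> w => [[]//|xw].
    split=> // i ilen; rewrite (same w) ?leqW //.
    exact: etrans (xw i ilen) (xy i ilen).
  rewrite jn /joint_kernel -[(z n).1]/(x n) -[(z n).2]/(y n) xnl -xy // eqxx /=.
  case: eqP => zS; last first.
    rewrite (_ : path_in _ _ _ = set0) ?measure0 ?mule0 //.
    rewrite path_in_joint; apply/seteqP; split=> // w [xw yw]; apply: zS.
    have /= <- := xw n.+1 (leqnn _); have /= <- := yw n.+1 (leqnn _).
    rewrite (same w) //.
    by move=> i ilen; apply: xw; exact: leqW.
  have := ML n x; rewrite !setTI => <-; congr (Pr _).
  rewrite path_in_joint; apply/seteqP; split=> w => [[]//|xw].
  have xwn : path_in M1 n x w by move=> i ilen; apply: xw; exact: leqW.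
  split=> // i; rewrite leq_eqVlt => /predU1P[->|ilen].
    by rewrite (same w) // xw.
  by rewrite (same w) ?leqW // xwn //; exact: xy.
(* [M1] starts in [E] almost surely, so the exit happens at a time [t >= 1] *)
have [n0|n0] := posnP n.
  by apply: null_case; rewrite n0 path_in0 start_left_null // -n0.
have ext : exists t, (0 < t)%N && ~~ in_left (x t) by exists n; rewrite n0.
case: (ex_minnP ext) => t /andP[t0 xt] tmin.
have tn : (t <= n)%N by apply: tmin; rewrite n0.
have exitE w : path_in M1 t x w -> exit_time M1 w = Some t.
  move=> xw; apply/first_timeP; split=> //; first by rewrite xw.
  move=> m /andP[m0 mt]; rewrite xw ?(ltnW mt) //; apply/negP => xm.
  by have := tmin m; rewrite m0 xm leqNgt mt => /(_ isT).
have [xy|nxy] := pselect (forall i, (i <= t)%N -> x i = y i); last first.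
  have e0 : path_in joint n z = set0.
    rewrite path_in_joint; apply/seteqP; split=> // w [xw yw]; apply: nxy.
    move=> i ilet; have ilen := leq_trans ilet tn.
    have Mi : M2 i w = M1 i w.
      by rewrite agree // exitE // => j jt; apply: xw; exact: leq_trans jt tn.
    by move: Mi; rewrite xw // yw.
  by rewrite path_inS e0 set0I measure0 mul0e.
have pastE : past_event M1 t x = path_in M1 t x.
  by apply/seteqP; split=> w => [[]//|xw]; split=> //; exact: exitE.
pose B := past_event M1 t x.
pose Z1 k w := M1 (t + k)%N w; pose Z2 k w := M2 (t + k)%N w.
pose x' k := x (t + k)%N; pose y' k := y (t + k)%N.
(* The conditional laws given [B] concern the processes shifted by [t]. *)
have split1 k : path_in M1 (t + k) x = B `&` path_in Z1 k x'.
  rewrite /B pastE; apply/seteqP; split=> w => [xw|[xt' xw] i itk].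
    split=> i ile; apply: xw; last by rewrite leq_add2l.
    exact: leq_trans ile (leq_addr _ _).
  have [it|/ltnW ti] := leqP i t; first exact: xt'.
  by rewrite -(subnKC ti); apply: xw; rewrite leq_subLR.
have split2 k : path_in joint (t + k) z = B `&` path_in Z1 k x' `&` path_in Z2 k y'.
  rewrite path_in_joint split1; apply/seteqP; split=> w [Bw yw]; split=> //.
    by move=> i ilek; apply: yw; rewrite leq_add2l.
  have [xw _] := Bw; move: xw; rewrite /B pastE => xw.
  move=> i itk; have [it|/ltnW ti] := leqP i t.
    by rewrite agree ?exitE // xw //; exact: xy.
  by rewrite -(subnKC ti); apply: yw; rewrite leq_subLR.
have nE : n = (t + (n - t))%N by rewrite subnKC.
move: (n - t)%N nE => k nE.
have mB : measurable B by rewrite /B pastE; exact: measurable_path.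
have mZ1 l : measurable (path_in Z1 l x') by apply: measurable_path => j; exact: m1.
have mZ2 l : measurable (path_in Z2 l y') by apply: measurable_path => j; exact: m2.
have fin A : measurable A -> Pr A \is a fin_num by exact: fin_num_measure.
have -> : joint_kernel (z n) (z n.+1) =
    transition K1 (x n) (x n.+1) * transition K2 (y n) (y n.+1).
  by rewrite /joint_kernel -[(z n).1]/(x n) (negbTE xnr).
apply: (@cancel_conditioning _ (Pr B) _ _ (Pr (B `&` path_in Z1 k x'))
  (Pr (B `&` path_in Z2 k y'))).
- exact: fin.
- exact: fin.
- exact: fin.
- exact/fin/measurableI.
- exact/fin/measurableI.
- by move=> B0; apply: null_subset B0 => //; rewrite nE split2 => w [[]].
- by move=> B0; apply: null_subset B0 => //; rewrite nE -addnS split2 => w [[]].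
- by rewrite nE split2; exact: ind.
- rewrite [in path_in joint _ _]nE -addnS split2.
  rewrite (ind t x k.+1 k.+1 x' y').
  have /markov_givenP/(_ k y') -> := M2L t x.
  rewrite -!split1 addnS; have := ML (t + k)%N x; rewrite !setTI => ->.
  by rewrite /y' addnS -nE.
Qed.

End JointChain.

(** * Rewards that count living times *)

Lemma sum_ltn (m s : nat) : (\sum_(l < m) (l < s))%N = minn m s.
Proof.
elim: m => [|m IHm]; first by rewrite big_ord0 min0n.
rewrite big_ord_recr /= IHm; have [ms|sm] := ltnP m s.
  by rewrite (minn_idPl ms) addn1.
by rewrite (minn_idPr (leqW sm)) addn0.
Qed.

Lemma absorbed_after (V : eqType) (u : nat -> option V) (s n : nat) :
  u 0%N <> None -> (forall i, u i = None -> u i.+1 = None) ->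
  first_time (fun i => u i == None) = Some s -> (u n == None) = (s <= n)%N.
Proof.
move=> u0 uS /first_timeP[s0 /eqP us smin]; have [sn|ns] := leqP s n.
  rewrite -(subnKC sn); elim: (n - s)%N => [|k IHk].
    by rewrite addn0 us.
  by rewrite addnS uS //; exact/eqP.
case: n ns => [|n] ns; first exact/eqP.
by apply/negbTE/smin.
Qed.

Section Reward.
Context (T : Type) (X : finType).

Definition alive1 (z : option X * option X) : nat := z.1 != None.
Definition alive2 (z : option X * option X) : nat := z.2 != None.

(** Coordinate [k] is alive exactly at the times [l < s_k], all of which precede
[maxn s1 s2]. *)
Lemma total_reward_alive (M1 M2 : nat -> T -> option X) (w : T) (s1 s2 : nat)
    (Z := kill (None, None) (fun n w => (M1 n w, M2 n w))) :
  M1 0%N w <> None -> M2 0%N w <> None ->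
  (forall i, M1 i w = None -> M1 i.+1 w = None) ->
  (forall i, M2 i w = None -> M2 i.+1 w = None) ->
  termination_time M1 w = Some s1 -> termination_time M2 w = Some s2 ->
  [/\ termination_time Z w = Some (maxn s1 s2),
      total_reward alive1 Z w = Some s1 & total_reward alive2 Z w = Some s2].
Proof.
move=> M10 M20 S1 S2 t1 t2.
have N1 n : (M1 n w == None) = (s1 <= n)%N by exact: absorbed_after t1.
have N2 n : (M2 n w == None) = (s2 <= n)%N by exact: absorbed_after t2.
have ZN n : (Z n w == None) = (maxn s1 s2 <= n)%N.
  rewrite /Z /kill geq_max -N1 -N2 -[_ == (None, None)]/(_ && _).
  by case: ifP.
have tZ : termination_time Z w = Some (maxn s1 s2).
  apply/first_timeP; split; last by move=> m /andP[_]; rewrite ZN ltnNge.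
    by move/first_timeP: t1 => [s10 _ _]; rewrite leq_max s10.
  by rewrite ZN.
have reward (r : option X * option X -> nat) (s : nat) : r (None, None) = 0%N ->
    (forall l, r (M1 l w, M2 l w) = (l < s)%N) -> (s <= maxn s1 s2)%N ->
    total_reward r Z w = Some s.
  move=> r0 rs smax; rewrite /total_reward tZ /=; congr Some.
  rewrite -[RHS](minn_idPr smax) -sum_ltn; apply: eq_bigr => l _.
  by rewrite -rs /Z /kill; case: eqP => [->|].
split=> //; apply: reward => //; rewrite ?leq_maxl ?leq_maxr //.
- by move=> l; rewrite /alive1 /= N1 ltnNge.
- by move=> l; rewrite /alive2 /= N2 ltnNge.
Qed.

End Reward.

Lemma CDPH_2_sub_MDPHstar (R : realType) : @CDPH_2 R `<=` @MDPHstar R.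
Proof.
move=> mu [E [S [alpha [P [U [Q1 [Q2 [d [T [Pr [M1 [M2]]]]]]]]]]]].
move=> [params chains law].
pose o : option (E + S) * option (E + S) := (None, None).
pose G := joint_kernel P U Q1 Q2.
pose gamma := kill o (joint M1 M2).
have [c1 [m2 [agree [_ [_ term2]]]]] := chains.
have [m1 M10 _ term1] := c1.
have M20 w : M2 0%N w = M1 0%N w by rewrite agree //; case: exit_time.
have mJ := measurable_joint chains.
have mgamma : measurable_process gamma by exact: measurable_kill.
have Go z : G o z = (z == o)%:R.
  case: z => x y; rewrite /G /joint_kernel /= -[_ == o]/(_ && _).
  by case: x y => [x|] [y|]; rewrite /= ?mulr0 ?mul0r ?mulr1.
have Gsum := sum_joint_kernel P U Q1 Q2.
have JM := joint_markov params chains.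
pose start x := if x is Some v then block_vector alpha (fun _ : S => 0) v else 0.
have good : {ae Pr, forall w, [/\ M1 0%N w <> None,
    forall i, M1 i w = None -> M1 i.+1 w = None,
    forall i, M2 i w = None -> M2 i.+1 w = None,
    exists s, termination_time M1 w = Some s &
    exists s, termination_time M2 w = Some s]}.
  have alive := ae_start_alive (block_probability_vector params) c1.
  have step := ae_no_zero_step mJ JM.
  have term : {ae Pr, forall w, (exists s, termination_time M1 w = Some s) /\
      exists s, termination_time M2 w = Some s}.
    by apply: filterS2 term1 term2.
  (* the kernel of the pair has no step that revives a coordinate *)
  apply: filterS3 alive step term => w aw sw [t1 t2]; split=> // i Mi.
    have := sw i; rewrite /joint_kernel /= Mi /=.
    by case: (M1 i.+1 w) => // ?; rewrite mul0r.
  have := sw i; rewrite /joint_kernel /= Mi.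
  case: (M2 i.+1 w) => // ?; case: (M1 i w) => [?|] /=; last by rewrite mulr0.
  by rewrite andbF mulr0.
exists (option (E + S) * option (E + S))%type.
exists (fun z => if z.1 == z.2 then start z.1 else 0).
exists (kill_matrix o G), (@alive1 _), (@alive2 _), d, T, Pr, gamma; split.
- have [a0 a1] := block_probability_vector params.
  split=> [z|]; first by case: ifP => // _; case: z.1.
  rewrite -(pair_bigA _ (fun x y => if x == y then start x else 0)) /=.
  rewrite -a1 -[RHS]add0r -(sum_option start); apply: eq_bigr => x _.
  by rewrite -big_mkcond (big_pred1 x) // => y /=; rewrite eq_sym.
- by apply: subprobability_kill => //; exact: joint_kernel_ge0 params.
- split=> //.
  + move=> [x y] /=; have [<-|xy] := eqVneq x y; last first.
      rewrite (_ : _ @^-1` _ = set0) ?measure0 //; apply/seteqP.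
      split=> w //=; rewrite /gamma /kill; case: ifP => // _ [] Mx My.
      by move: xy; rewrite -Mx -My M20 eqxx.
    case: x => [v|] /=.
      rewrite -M10; congr (Pr _); apply/seteqP; split=> w /=; rewrite /gamma /kill.
        by case: ifP => // _ [].
      by move=> vw; rewrite /joint M20 vw.
    rewrite (_ : _ @^-1` _ = set0) ?measure0 //; apply/seteqP; split=> w //=.
    rewrite /gamma /kill; case: eqP => // ne [] Mw Mw2; apply: ne.
    by rewrite /joint Mw Mw2.
  + by apply/markov_givenP; exact: markov_on_kill.
  + apply: filterS good => w [aw S1 S2 [s1 t1] [s2 t2]].
    exists (maxn s1 s2).
    by have [] := total_reward_alive aw _ S1 S2 t1 t2; rewrite ?M20.
- apply: has_law_ae law => [n|n|n|n|].
  + by apply: measurable_omap_time => k; exact: measurable_termination_time.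
  + by apply: measurable_omap_time => k; exact: measurable_termination_time.
  + exact: measurable_total_reward.
  + exact: measurable_total_reward.
  + apply: filterS good => w [aw S1 S2 [s1 t1] [s2 t2]].
    have a2 : M2 0%N w <> None by rewrite M20.
    have [_ r1 r2] := total_reward_alive aw a2 S1 S2 t1 t2.
    by rewrite t1 t2 /= !subn0; split; apply/esym.
Qed.

Theorem proposition2p5 (R : realType) :
  @mDPH R `<=` @CDPH_1 R /\ @CDPH_2 R `<=` @MDPHstar R.
Proof. by split; [exact: mDPH_sub_CDPH_1 | exact: CDPH_2_sub_MDPHstar]. Qed.
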